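(* Let $S_1,\dots,S_m\subseteq N$. Then the subgroup $\bigcap_{i=1}^m Q_{S_i}$ of $P_n$ is generated by the set of monic commutators $x$ such that $\sigma(x)\cap S_i\neq\emptyset$ for all $1\le i\le m$.
   Context: $P_n$ denotes the pure braid group on $n$ strands, generated by elements $p_{a,b}$ for $1\le a<b\le n$ subject to the relations: (A) $p_{a,b}p_{a,c}p_{b,c}=p_{a,c}p_{b,c}p_{a,b}=p_{b,c}p_{a,b}p_{a,c}$ for $1\le a<b<c\le n$; (B) $p_{a,b}p_{c,d}=p_{c,d}p_{a,b}$ and $p_{a,d}p_{b,c}=p_{b,c}p_{a,d}$ for $1\le a<b<c<d\le n$; (C) $p_{a,c}p_{b,c}^{-1}p_{b,d}p_{b,c}=p_{b,c}^{-1}p_{b,d}p_{b,c}p_{a,c}$ for $1\le a<b<c<d\le n$. Let $N=\{1,\dots,n\}$. For $S\subseteq N$: $P_S$ is the subgroup generated by the $p_{a,b}$ with $a\in S$ and $b\in S$; $Q_S$ is the subgroup generated by the $p_{a,b}$ with $a\in S$ or $b\in S$. Commutator convention: $[x,y]=x^{-1}y^{-1}xy$. Monic commutators are defined recursively: each $p_{a,b}$ and $p_{a,b}^{-1}$ ($1\le a<b\le n$) is a monic commutator; if $x,y$ are monic commutators and $[x,y]\neq1$, then $[x,y]$ is a monic commutator. The support $\sigma(x)$ of $x\in P_n$ is the intersection of all $S\subseteq N$ such that $x\in P_S$. *)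

(* Defs.v *)
From Stdlib Require Import Arith.

Record group := Group {
  carrier :> Type;
  gmul : carrier -> carrier -> carrier;
  ginv : carrier -> carrier;
  gone : carrier;
  gmulA : forall x y z, gmul x (gmul y z) = gmul (gmul x y) z;
  gmul1 : forall x, gmul gone x = x;
  gmulV : forall x, gmul (ginv x) x = gone
}.

Arguments gmul {g}.
Arguments ginv {g}.
Arguments gone {g}.

Definition is_hom (G H : group) (f : G -> H) : Prop :=
  forall x y, f (gmul x y) = gmul (f x) (f y).

Definition comm {G : group} (x y : G) : G :=
  gmul (gmul (gmul (ginv x) (ginv y)) x) y.

Definition braid_rels (n : nat) (H : group) (q : nat -> nat -> H) : Prop :=
  (forall a b c, 1 <= a -> a < b -> b < c -> c <= n ->
     gmul (gmul (q a b) (q a c)) (q b c) = gmul (gmul (q a c) (q b c)) (q a b) /\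
     gmul (gmul (q a c) (q b c)) (q a b) = gmul (gmul (q b c) (q a b)) (q a c)) /\
  (forall a b c d, 1 <= a -> a < b -> b < c -> c < d -> d <= n ->
     gmul (q a b) (q c d) = gmul (q c d) (q a b) /\
     gmul (q a d) (q b c) = gmul (q b c) (q a d)) /\
  (forall a b c d, 1 <= a -> a < b -> b < c -> c < d -> d <= n ->
     gmul (gmul (gmul (q a c) (ginv (q b c))) (q b d)) (q b c)
     = gmul (gmul (gmul (ginv (q b c)) (q b d)) (q b c)) (q a c)).

(* (G, p) is a presentation of the pure braid group P_n: p satisfies the
   relations and (G, p) is universal among such families (so G is the group
   with generators p_{a,b} and relations (A),(B),(C), up to unique iso). *)
Definition is_pure_braid_group (n : nat) (G : group) (p : nat -> nat -> G) : Prop :=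
  braid_rels n G p /\
  forall (H : group) (q : nat -> nat -> H), braid_rels n H q ->
    exists f : G -> H,
      is_hom G H f /\
      (forall a b, 1 <= a -> a < b -> b <= n -> f (p a b) = q a b) /\
      (forall g : G -> H, is_hom G H g ->
         (forall a b, 1 <= a -> a < b -> b <= n -> g (p a b) = q a b) ->
         forall x, g x = f x).

Inductive gen {G : group} (X : G -> Prop) : G -> Prop :=
  | gen_one : gen X gone
  | gen_in : forall x, X x -> gen X x
  | gen_inv : forall x, gen X x -> gen X (ginv x)
  | gen_mul : forall x y, gen X x -> gen X y -> gen X (gmul x y).

Definition P_S (n : nat) {G : group} (p : nat -> nat -> G) (S : nat -> Prop) : G -> Prop :=
  gen (fun x => exists a b, 1 <= a /\ a < b /\ b <= n /\ S a /\ S b /\ x = p a b).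

Definition Q_S (n : nat) {G : group} (p : nat -> nat -> G) (S : nat -> Prop) : G -> Prop :=
  gen (fun x => exists a b, 1 <= a /\ a < b /\ b <= n /\ (S a \/ S b) /\ x = p a b).

Definition support (n : nat) {G : group} (p : nat -> nat -> G) (x : G) (k : nat) : Prop :=
  forall S : nat -> Prop, (forall j, S j -> 1 <= j <= n) -> P_S n p S x -> S k.

Inductive monic (n : nat) {G : group} (p : nat -> nat -> G) : G -> Prop :=
  | monic_gen : forall a b, 1 <= a -> a < b -> b <= n -> monic n p (p a b)
  | monic_geninv : forall a b, 1 <= a -> a < b -> b <= n -> monic n p (ginv (p a b))
  | monic_comm : forall x y, monic n p x -> monic n p y -> comm x y <> gone ->
                 monic n p (comm x y).

(* Main.v *)
(* Give a commutator of generators the union of the index pairs involved as its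
   formal support.  Commutator collection writes every braid as a product, over
   the subsets T of N in an order extending inclusion, of words in monic
   commutators of formal support T.  If x lies in every Q_{S_i}, factors are
   removed from the left: when T meets all S_i, its factor lies in every Q_{S_i}
   too; when T misses some S_i, the retraction of P_n onto P_T kills x and every
   later factor, so the factor at T is trivial.
   Conversely such commutators lie in each Q_{S_i} because Q_S is normal.  The
   delicate case of normality is the conjugation of p_{b,d} by p_{a,c} for
   a < b < c < d, when d or a is the strand defining Q: see
   [crossing_normalizes]. *)

Require Import Defs.
From Stdlib Require Import Arith Lia Bool Classical ProofIrrelevance.

Declare Scope grp_scope.
Local Open Scope grp_scope.
Local Notation "x * y" := (gmul x y) : grp_scope.
Local Notation "x ^-1" := (ginv x) (at level 3, left associativity, format "x ^-1") : grp_scope.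

(** * Identities valid in every group *)

Lemma mulgA {G : group} (x y z : G) : (x * y) * z = x * (y * z).
Proof. symmetry; apply gmulA. Qed.

Lemma mulKg {G : group} (x y : G) : x^-1 * (x * y) = y.
Proof. now rewrite gmulA, gmulV, gmul1. Qed.

Lemma mulg_cancel {G : group} (x y z : G) : x * y = x * z -> y = z.
Proof. intros H. now rewrite <- (mulKg x y), H, mulKg. Qed.

Lemma mulg1 {G : group} (x : G) : x * gone = x.
Proof. apply (mulg_cancel x^-1). now rewrite gmulA, gmulV, gmul1. Qed.

Lemma mulgV {G : group} (x : G) : x * x^-1 = gone.
Proof. apply (mulg_cancel x^-1). now rewrite mulKg, mulg1. Qed.

Lemma mulVKg {G : group} (x y : G) : x * (x^-1 * y) = y.
Proof. now rewrite gmulA, mulgV, gmul1. Qed.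

Lemma invV {G : group} (x : G) : x^-1^-1 = x.
Proof. apply (mulg_cancel x^-1). now rewrite mulgV, gmulV. Qed.

Lemma invM {G : group} (x y : G) : (x * y)^-1 = y^-1 * x^-1.
Proof. apply (mulg_cancel (x * y)). now rewrite mulgV, mulgA, mulVKg, mulgV. Qed.

Lemma inv1 {G : group} : (gone : G)^-1 = gone.
Proof. apply (mulg_cancel gone). now rewrite mulgV, gmul1. Qed.

(* These ten rules are the complete rewriting system of group theory, so [grp] reduces words
   freely. *)
#[local] Hint Rewrite @mulgA @mulKg @mulVKg @invV @invM @inv1 @mulg1 @gmul1 @mulgV @gmulV : grp.
Ltac grp := autorewrite with grp.
Ltac grp_in H := autorewrite with grp in H.

Lemma gen_mono {G : group} (X Y : G -> Prop) :
  (forall x, X x -> gen Y x) -> forall x, gen X x -> gen Y x.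
Proof. intros H x Hx; induction Hx; auto using gen_one, gen_inv, gen_mul. Qed.

(** * Conjugation and normalizers *)

Definition conjg {G : group} (g x : G) : G := g * x * g^-1.

Lemma conjM {G : group} (g x y : G) : conjg g (x * y) = conjg g x * conjg g y.
Proof. unfold conjg; now grp. Qed.

Lemma conjV {G : group} (g x : G) : conjg g x^-1 = (conjg g x)^-1.
Proof. unfold conjg; now grp. Qed.

Lemma conj1 {G : group} (g : G) : conjg g gone = gone.
Proof. unfold conjg; now grp. Qed.

Lemma conj_mul {G : group} (g h x : G) : conjg (g * h) x = conjg g (conjg h x).
Proof. unfold conjg; now grp. Qed.

Lemma conjVK {G : group} (g x : G) : conjg g^-1 (conjg g x) = x.
Proof. unfold conjg; now grp. Qed.

Lemma conj_fix {G : group} (g x : G) : g * x = x * g -> conjg g x = x.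
Proof. intros H; unfold conjg; rewrite H; now grp. Qed.

Lemma conj_fixV {G : group} (g x : G) : conjg g x = x -> conjg g^-1 x = x.
Proof. intros H. rewrite <- H at 1. apply conjVK. Qed.

Lemma conj_fix_sym {G : group} (g x : G) : conjg g x = x -> conjg x g = g.
Proof.
  intros H. apply conj_fix. rewrite <- H at 1. unfold conjg. now grp.
Qed.

Lemma comm_conj {G : group} (x y : G) : comm x y = x^-1 * conjg y^-1 x.
Proof. unfold comm, conjg; now grp. Qed.

(** Both directions are required: in an infinite group a conjugate of a subgroup may be properly
    contained in it. *)
Definition normalizes {G : group} (A : G -> Prop) (g : G) : Prop :=
  forall x, A x -> A (conjg g x) /\ A (conjg g^-1 x).

Lemma normalizes_mul {G : group} (A : G -> Prop) (g h : G) :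
  normalizes A g -> normalizes A h -> normalizes A (g * h).
Proof.
  intros Hg Hh x Hx; split; rewrite ?invM, conj_mul.
  - now apply Hg, Hh.
  - now apply Hh, Hg.
Qed.

Lemma normalizes_inv {G : group} (A : G -> Prop) (g : G) :
  normalizes A g -> normalizes A g^-1.
Proof. intros Hg x Hx; rewrite invV; split; now apply Hg. Qed.

Lemma normalizes_gen {G : group} (X : G -> Prop) (g : G) :
  (forall x, X x -> gen X (conjg g x) /\ gen X (conjg g^-1 x)) ->
  normalizes (gen X) g.
Proof.
  intros H x Hx; induction Hx as [|x Hx|x _ [IH IH']|x y _ [IHx IHx'] _ [IHy IHy']].
  - rewrite !conj1; split; apply gen_one.
  - now apply H.
  - rewrite !conjV; split; now apply gen_inv.
  - rewrite !conjM; split; now apply gen_mul.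
Qed.

Lemma normalizes_self {G : group} (X : G -> Prop) (g : G) :
  gen X g -> normalizes (gen X) g.
Proof.
  intros Hg x Hx; unfold conjg; split; auto using gen_mul, gen_inv.
Qed.

Lemma normalizes_by_gen {G : group} (A X : G -> Prop) :
  (forall x, X x -> normalizes A x) -> forall x, gen X x -> normalizes A x.
Proof.
  intros H x Hx; induction Hx.
  - intros y Hy; rewrite inv1; unfold conjg; grp; now split.
  - auto.
  - now apply normalizes_inv.
  - now apply normalizes_mul.
Qed.

(** * Triples satisfying relation (A) *)

Definition cyclic {G : group} (x y z : G) : Prop :=
  x * y * z = y * z * x /\ y * z * x = z * x * y.

Lemma cyclic_rot {G : group} (x y z : G) : cyclic x y z -> cyclic y z x.
Proof. intros [H1 H2]; split; congruence. Qed.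

(** The second equation gives the conjugate of [y]. The first says that [x] commutes with [y * z],
    whence the conjugate of [z]. *)
Lemma cyclic_conj {G : group} (x y z : G) : cyclic x y z ->
  conjg x y = z^-1 * y * z /\ conjg x z = z^-1 * y^-1 * z * y * z.
Proof.
  intros [H1 H2].
  assert (Hy : conjg x y = z^-1 * y * z).
  { unfold conjg. apply (mulg_cancel z). rewrite !gmulA, <- H2. now grp. }
  split; [exact Hy|].
  assert (Hz : conjg x (y * z) = y * z).
  { apply conj_fix. rewrite gmulA. exact H1. }
  rewrite conjM, Hy in Hz. apply (mulg_cancel (z^-1 * y * z)).
  rewrite Hz. now grp.
Qed.

Lemma cyclic_conjV {G : group} (x y z : G) : cyclic x y z ->
  conjg x^-1 z = y * z * y^-1 /\ conjg x^-1 y = y * z * y * z^-1 * y^-1.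
Proof.
  intros H; destruct (cyclic_conj _ _ _ H) as [Hy Hz]; split.
  - rewrite <- (conjVK x (y * z * y^-1)). f_equal.
    rewrite !conjM, conjV, Hy, Hz. now grp.
  - rewrite <- (conjVK x (y * z * y * z^-1 * y^-1)). f_equal.
    rewrite !conjM, !conjV, Hy, Hz. now grp.
Qed.

(** All four conjugates are words in [y] and [z]: each member of a triangle normalizes the subgroup
    generated by the other two. *)
Lemma cyclic_gen {G : group} (X : G -> Prop) (x y z : G) :
  cyclic x y z -> gen X y -> gen X z ->
  (gen X (conjg x y) /\ gen X (conjg x^-1 y)) /\
  (gen X (conjg x z) /\ gen X (conjg x^-1 z)).
Proof.
  intros H Hy Hz.
  destruct (cyclic_conj _ _ _ H) as [-> ->], (cyclic_conjV _ _ _ H) as [-> ->].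
  repeat split; auto 10 using gen_mul, gen_inv.
Qed.

Lemma fix_gen {G : group} (X : G -> Prop) (x y : G) :
  x * y = y * x -> gen X y -> gen X (conjg x y) /\ gen X (conjg x^-1 y).
Proof.
  intros H Hy. apply conj_fix in H. rewrite (conj_fixV _ _ H), H. now split.
Qed.

(** * Crossing pairs on four strands *)

Definition gen3 {G : group} (x y z : G) : G -> Prop :=
  gen (fun g => g = x \/ g = y \/ g = z).

(* [a, b, c, u, v, w] stand for p12, p13, p23, p14, p24, p34.  The full twist
   [d] is first shown to centralize only the subgroup [E].  Since [v] normalizes [E] and [d v d^-1] is a conjugate of [v] in
   [E<v>], the element [zeta = d v d^-1 v^-1] lies in [E], so [d] fixes it. *)
Lemma crossing_normalizes {G : group} (a b c u v w : G) :
  cyclic a b c -> cyclic a u v -> cyclic b u w -> cyclic c v w ->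
  a * w = w * a -> u * c = c * u ->
  b * (c^-1 * v * c) = (c^-1 * v * c) * b ->
  normalizes (gen3 u v w) b.
Proof.
  intros Habc Hauv Hbuw Hcvw Haw Huc HC.
  set (K := gen3 u v w).
  assert (Ku : K u) by (apply gen_in; auto).
  assert (Kv : K v) by (apply gen_in; auto).
  assert (Kw : K w) by (apply gen_in; auto).
  (* The omitted [b] and [v] form the crossing pair; on the other four generators conjugation by [d]
     is computed from (A) and (B) alone. *)
  set (E := gen (fun g => g = a \/ g = c \/ g = u \/ g = w)).
  assert (Ea : E a) by (apply gen_in; auto).
  assert (Ec : E c) by (apply gen_in; auto).
  assert (Eu : E u) by (apply gen_in; auto).
  assert (Ew : E w) by (apply gen_in; auto).
  assert (aK : normalizes K a).
  { apply normalizes_gen; intros x [->|[->| ->]].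
    - now apply (cyclic_gen _ _ _ _ Hauv).
    - now apply (cyclic_gen _ _ _ _ Hauv).
    - apply fix_gen; auto. }
  assert (cK : normalizes K c).
  { apply normalizes_gen; intros x [->|[->| ->]].
    - apply fix_gen; auto.
    - now apply (cyclic_gen _ _ _ _ Hcvw).
    - now apply (cyclic_gen _ _ _ _ Hcvw). }
  assert (vE : normalizes E v).
  { pose proof (cyclic_rot _ _ _ (cyclic_rot _ _ _ Hauv)) as Hvau.
    pose proof (cyclic_rot _ _ _ Hcvw) as Hvwc.
    apply normalizes_gen; intros x [->|[->|[->| ->]]].
    - now apply (cyclic_gen _ _ _ _ Hvau).
    - now apply (cyclic_gen _ _ _ _ Hvwc).
    - now apply (cyclic_gen _ _ _ _ Hvau).
    - now apply (cyclic_gen _ _ _ _ Hvwc). }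
  set (t := u * v * w).
  assert (Kt : K t) by (unfold t; repeat apply gen_mul; auto).
  destruct (cyclic_conj _ _ _ Hauv) as [au av].
  destruct (cyclic_conj _ _ _ Hbuw) as [bu bw].
  destruct (cyclic_conj _ _ _ Hcvw) as [cv cw].
  pose proof (conj_fix _ _ Haw) as aw.
  pose proof (conj_fix _ _ (eq_sym Huc)) as cu.
  pose proof (conj_fix _ _ HC) as bk.
  assert (at_ : conjg a t = t) by (unfold t; rewrite !conjM, au, av, aw; now grp).
  assert (ct : conjg c t = t) by (unfold t; rewrite !conjM, cu, cv, cw; now grp).
  set (d := t * (a * b * c)).
  (* This form makes [b] act first, as needed for [w] and, through (C), for the conjugate of [v] by
     [c^-1]. *)
  assert (d2 : d = t * (c * a * b)).
  { unfold d. destruct Habc as [-> ->]. reflexivity. }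
  assert (dE : forall x, E x -> conjg d x = x).
  { intros x Hx; induction Hx as [|x Hx|x _ IH|x y _ IHx _ IHy].
    - apply conj1.
    - destruct Hx as [->|[->|[->| ->]]].
      + apply conj_fix_sym. unfold d. rewrite conjM, at_. f_equal.
        apply conj_fix. destruct Habc as [H1 H2].
        transitivity (a * (b * c * a)); [now rewrite H1|now grp].
      + apply conj_fix_sym. unfold d. rewrite conjM, ct. f_equal.
        apply conj_fix. destruct Habc as [H1 H2]. transitivity (c * a * b * c); [now grp|].
        now rewrite <- H2, <- H1.
      + unfold d. rewrite !conj_mul, cu, bu, !conjM, conjV, aw, au.
        unfold conjg, t. now grp.
      + rewrite d2, !conj_mul, bw, !(conjM a), !(conjV a), aw, au.
        rewrite !(conjM c), !(conjV c), !(conjM c), !(conjV c), cu, cv, cw.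
        unfold conjg, t. now grp.
    - now rewrite conjV, IH.
    - now rewrite conjM, IHx, IHy. }
  (* Since [d] commutes with [c], it acts on [v] as [c * d * c^-1]. With [d = t * (c * a * b)],
     relation (C) lets [b] be dropped, which leaves [f]. Free of [b], this word visibly normalizes
     [K]. *)
  set (f := c * t * c * a * c^-1).
  assert (dv : conjg d v = conjg f v).
  { assert (H : conjg d v = conjg c (conjg d (conjg c^-1 v))).
    { rewrite <- !conj_mul. f_equal.
      rewrite <- (conj_fix_sym _ _ (dE c Ec)) at 1. unfold conjg. now grp. }
    rewrite H, d2. unfold f. rewrite !conj_mul.
    replace (conjg b (conjg c^-1 v)) with (conjg c^-1 v); [reflexivity|].
    symmetry. unfold conjg at 2 3. rewrite invV. exact bk. }
  set (zeta := conjg d v * v^-1).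
  assert (Ktau : K (conjg d v)).
  { rewrite dv. enough (fK : normalizes K f) by now apply fK.
    unfold f. apply normalizes_mul; [|now apply normalizes_inv].
    apply normalizes_mul; [|assumption]. apply normalizes_mul; [|assumption].
    apply normalizes_mul; [assumption|]. now apply normalizes_self. }
  assert (Kz : K zeta) by (apply gen_mul; [|apply gen_inv]; assumption).
  assert (Ez : E zeta).
  (* The second clause says that [g] commutes with [v] modulo [E]. Carrying the first clause along
     makes [R] closed under products, so it suffices that [f] is a word in elements of [E] and
     [v]. *)
  { set (R := fun g => normalizes E g /\ E (conjg g v * v^-1)).
    assert (RE : forall g, E g -> R g).
    { intros g Hg; split; [now apply normalizes_self|].
      replace (conjg g v * v^-1) with (g * conjg v g^-1) by (unfold conjg; now grp).
      apply gen_mul; [assumption|]. now apply vE, gen_inv. }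
    assert (Rv : R v).
    { split; [assumption|]. unfold conjg. grp. apply gen_one. }
    assert (RM : forall g h, R g -> R h -> R (g * h)).
    { intros g h [Hg Eg] [Hh Eh]; split; [now apply normalizes_mul|].
      replace (conjg (g * h) v * v^-1)
        with (conjg g (conjg h v * v^-1) * (conjg g v * v^-1))
        by (unfold conjg; now grp).
      apply gen_mul; [now apply Hg|assumption]. }
    unfold zeta. rewrite dv. enough (Rf : R f) by apply Rf.
    unfold f, t. repeat apply RM; auto. apply RE, gen_inv, Ec. }
  (* Apply conjugation by [d^-1], which fixes [zeta], to [d * v * d^-1 = zeta * v]. *)
  assert (dV : conjg d^-1 v = zeta^-1 * v).
  { apply (mulg_cancel zeta). rewrite mulVKg.
    rewrite <- (conj_fixV _ _ (dE _ Ez)) at 1. rewrite <- conjM.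
    unfold zeta. grp. apply conjVK. }
  assert (dK : normalizes K d).
  { apply normalizes_gen; intros x [->|[->| ->]].
    - rewrite (conj_fixV _ _ (dE _ Eu)), (dE _ Eu). now split.
    - rewrite dV. split; [assumption|]. apply gen_mul; [apply gen_inv|]; assumption.
    - rewrite (conj_fixV _ _ (dE _ Ew)), (dE _ Ew). now split. }
  (* Solve [d = t * (a * b * c)] for [b]: every other factor is already known to normalize [K]. *)
  replace b with (a^-1 * t^-1 * d * c^-1) by (unfold d; now grp).
  apply normalizes_mul; [|now apply normalizes_inv].
  apply normalizes_mul; [|assumption].
  apply normalizes_mul; apply normalizes_inv; [assumption|].
  now apply normalizes_self.
Qed.

Definition opposite (G : group) : group :=
  Group G (fun x y => y * x) ginv gone
    (fun x y z => mulgA z y x) mulg1 mulgV.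

Lemma gen_opposite {G : group} (X : G -> Prop) (x : G) :
  gen (G := opposite G) X x <-> gen X x.
Proof.
  split; intros H; induction H as [|x Hx|x _ IH|x y _ IHx _ IHy].
  - apply (gen_one (G := G)).
  - now apply gen_in.
  - exact (gen_inv X x IH).
  - exact (gen_mul X y x IHy IHx).
  - apply (gen_one (G := opposite G)).
  - now apply gen_in.
  - exact (gen_inv (G := opposite G) X x IH).
  - exact (gen_mul (G := opposite G) X y x IHy IHx).
Qed.

(* Reversing both the order of the strands and the words preserves the relations. *)
Lemma crossing_normalizes_sym {G : group} (a b c u v w : G) :
  cyclic a b c -> cyclic a u v -> cyclic b u w -> cyclic c v w ->
  a * w = w * a -> u * c = c * u ->
  b * (c^-1 * v * c) = (c^-1 * v * c) * b ->
  normalizes (gen3 u b a) v.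
Proof.
  intros [Habc Habc'] [Hauv Hauv'] [Hbuw Hbuw'] [Hcvw Hcvw'] Haw Huc HC.
  (* Relation (C) with the conjugation by [c] moved from [v] to [b]; read backwards, it is (C) with
     these two exchanged. *)
  assert (HC' : c * b * c^-1 * v = v * c * b * c^-1).
  { apply (mulg_cancel c^-1).
    transitivity (b * (c^-1 * v * c) * c^-1); [|rewrite HC]; now grp. }
  (* Sending strand [k] to [5 - k] exchanges [a] with [w] and [b] with [v], and fixes [c] and
     [u]. *)
  assert (H : normalizes (G := opposite G) (gen3 (G := opposite G) u b a) v).
  { apply (crossing_normalizes (G := opposite G) w v c u b a);
      try split; cbn; rewrite ?gmulA; congruence. }
  intros x Hx.
  destruct (H x (proj2 (gen_opposite _ _) Hx)) as [H1 H2].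
  apply (proj1 (gen_opposite _ _)) in H1, H2.
  unfold conjg in *; cbn in *. rewrite gmulA in H1, H2.
  rewrite invV in *. now split.
Qed.

(** * Normality of the subgroups [Q_S] *)

(** Since [g] fixes [c^-1 * y * c], its action on [y] is determined by its action on [c]. *)
Lemma twisted_gen {G : group} (X : G -> Prop) (g c y : G) :
  g * (c^-1 * y * c) = (c^-1 * y * c) * g -> gen X y -> gen X c ->
  gen X (conjg g c) /\ gen X (conjg g^-1 c) ->
  gen X (conjg g y) /\ gen X (conjg g^-1 y).
Proof.
  intros H Hy Hc [H1 H2]. apply conj_fix in H.
  replace y with (c * (c^-1 * y * c) * c^-1) by now grp.
  rewrite !(conjM _ (c * _)), !(conjM _ c), !(conjV _ c), (conj_fixV _ _ H), H.
  split; auto 10 using gen_mul, gen_inv.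
Qed.

Lemma normalizes_gen3 {G : group} (X : G -> Prop) (g x y z : G) :
  normalizes (gen3 x y z) g -> gen X x -> gen X y -> gen X z ->
  forall r, r = x \/ r = y \/ r = z -> gen X (conjg g r) /\ gen X (conjg g^-1 r).
Proof.
  intros H Hx Hy Hz r Hr.
  assert (Hsub : forall s, gen3 x y z s -> gen X s).
  { intros s Hs; induction Hs as [|s [->|[->| ->]]| |];
      auto using gen_one, gen_inv, gen_mul. }
  split; apply Hsub, H, gen_in, Hr.
Qed.

Definition generators (n : nat) {G : group} (p : nat -> nat -> G) (x : G) : Prop :=
  exists a b, 1 <= a /\ a < b /\ b <= n /\ x = p a b.

(** A generator through strand [k] is compared with [p a b]: a shared endpoint is settled by (A),
    separated or nested pairs by (B), and crossing pairs by (C) or the crossing lemmas, depending on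
    which end is [k]. *)
Lemma Q_singleton_normal (n : nat) (G : group) (p : nat -> nat -> G) (k a b : nat) :
  braid_rels n G p -> 1 <= a -> a < b -> b <= n ->
  normalizes (Q_S n p (fun j => j = k)) (p a b).
Proof.
  intros [RA [RB RC]] Ha Hab Hb. unfold Q_S.
  set (X := fun x => _).
  assert (HX : forall i j, 1 <= i -> i < j -> j <= n -> i = k \/ j = k -> gen X (p i j)).
  { intros i j Hi Hij Hj Hk. apply gen_in. exists i, j. auto. }
  assert (Hcyc : forall a b c, 1 <= a -> a < b -> b < c -> c <= n ->
    cyclic (p a b) (p a c) (p b c)) by exact RA.
  assert (H3 : forall a b c d, 1 <= a -> a < b -> b < c -> c < d -> d <= n ->
    p a c * ((p b c)^-1 * p b d * p b c) = ((p b c)^-1 * p b d * p b c) * p a c).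
  { intros. rewrite <- RC by assumption. now grp. }
  assert (Hd : forall a b c d, 1 <= a -> a < b -> b < c -> c < d -> d <= n ->
    normalizes (gen3 (p a d) (p b d) (p c d)) (p a c) /\
    normalizes (gen3 (p a d) (p a c) (p a b)) (p b d)).
  { intros a' b' c' d' ? ? ? ? ?.
    split; [apply (crossing_normalizes (p a' b') (p a' c') (p b' c'))
           |apply (crossing_normalizes_sym (p a' b') (p a' c') (p b' c') _ _ (p c' d'))];
      try (apply Hcyc; lia); try (apply H3; lia); now apply (RB a' b' c' d'). }
  destruct (Nat.eq_dec a k) as [Ea|Na]; [apply normalizes_self; auto|].
  destruct (Nat.eq_dec b k) as [Eb|Nb]; [apply normalizes_self; auto|].
  apply normalizes_gen. intros x (i & j & Hi & Hij & Hj & Hk & ->).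
  (* Pairs sharing an endpoint: [a], [b], [k] form a triangle, and (A) is rotated according to the
     position of [k]. *)
  assert (Hin : forall o, o = a \/ o = b -> 1 <= k <= n ->
    (o < k -> gen X (conjg (p a b) (p o k)) /\ gen X (conjg (p a b)^-1 (p o k))) /\
    (k < o -> gen X (conjg (p a b) (p k o)) /\ gen X (conjg (p a b)^-1 (p k o)))).
  { intros o Ho Hkn. destruct (lt_eq_lt_dec k a) as [[L|L]|L]; [|congruence|].
    - destruct (cyclic_gen X (p a b) (p k a) (p k b)) as [H1 H2];
        [apply cyclic_rot, cyclic_rot, Hcyc; lia|apply HX; lia..|].
      destruct Ho as [-> | ->]; split; intros; [lia|assumption|lia|assumption].
    - destruct (lt_eq_lt_dec k b) as [[L'|L']|L']; [|congruence|].
      + destruct (cyclic_gen X (p a b) (p k b) (p a k)) as [H1 H2];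
          [apply cyclic_rot, Hcyc; lia|apply HX; lia..|].
        destruct Ho as [-> | ->]; split; intros; [assumption|lia|lia|assumption].
      + destruct (cyclic_gen X (p a b) (p a k) (p b k)) as [H1 H2];
          [apply Hcyc; lia|apply HX; lia..|].
        destruct Ho as [-> | ->]; split; intros; [assumption|lia|assumption|lia]. }
  assert (Pij : gen X (p i j)) by (apply HX; auto).
  assert (Hends : i = a \/ i = b \/ j = a \/ j = b \/
                  (i <> a /\ i <> b /\ j <> a /\ j <> b)) by lia.
  assert (Hfix : p a b * p i j = p i j * p a b ->
    gen X (conjg (p a b) (p i j)) /\ gen X (conjg (p a b)^-1 (p i j))).
  { intros H. now apply fix_gen. }
  destruct Hends as [E|[E|[E|[E|(N1 & N2 & N3 & N4)]]]].
  1,2: destruct Hk as [Hk|Hk]; [lia|subst k; apply Hin; lia].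
  1,2: destruct Hk as [Hk|Hk]; [subst k; apply Hin; lia|lia].
  (* Disjoint pairs: the first four positions commute by (B), and the last two cross. *)
  assert (Hpos : (b < i \/ j < a \/ (a < i /\ j < b) \/ (i < a /\ b < j)) \/
                 (a < i /\ i < b /\ b < j) \/ (i < a /\ a < j /\ j < b)) by lia.
  destruct Hpos as [[L|[L|[L|L]]]|[L|L]].
  - apply Hfix. apply (RB a b i j); lia.
  - apply Hfix. symmetry. apply (RB i j a b); lia.
  - apply Hfix. apply (RB a i j b); lia.
  - apply Hfix. symmetry. apply (RB i a b j); lia.
  - destruct Hk as [-> | ->].
    + apply (twisted_gen X _ (p k b)); [apply H3; lia|apply HX; lia..|].
      apply Hin; lia.
    + apply (normalizes_gen3 X _ (p a k) (p i k) (p b k));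
        [apply (Hd a i b k); lia|apply HX; lia..|auto].
  - destruct Hk as [-> | ->].
    + apply (normalizes_gen3 X _ (p k b) (p k j) (p k a));
        [apply (Hd k a j b); lia|apply HX; lia..|auto].
    (* Here (C) says that [p i k] commutes with a conjugate of [p a b]. Moving the conjugation to
       [p i k] inverts the twisting element. *)
    + apply (twisted_gen X _ (p a k)^-1);
        [|apply HX; lia|apply gen_inv, HX; lia|].
      * pose proof (RC i a k b) as H. rewrite invV.
        apply (mulg_cancel (p a k)^-1). apply (f_equal (fun x => x * (p a k)^-1)) in H; [|lia..].
        grp_in H. now grp.
      * rewrite !conjV. destruct (Hin a) as [H _]; [auto|lia|].
        split; apply gen_inv, H; lia.
Qed.

(** Each generator of [Q_S] lies in the subgroup attached to a single strand of [S], which is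
    contained in [Q_S]. *)
Lemma Q_normal (n : nat) (G : group) (p : nat -> nat -> G) (S : nat -> Prop) (g : G) :
  braid_rels n G p -> gen (generators n p) g -> normalizes (Q_S n p S) g.
Proof.
  intros HR. apply normalizes_by_gen. intros x (a & b & Ha & Hab & Hb & ->).
  apply normalizes_gen. intros y (i & j & Hi & Hij & Hj & HS & ->).
  assert (Hk : exists k, S k /\ (i = k \/ j = k)) by (destruct HS; eauto).
  destruct Hk as (k & HSk & Hk).
  assert (Hy : Q_S n p (fun o => o = k) (p i j)).
  { apply gen_in. exists i, j. auto 10. }
  destruct (Q_singleton_normal n G p k a b HR Ha Hab Hb _ Hy) as [H1 H2].
  assert (Hsub : forall z, Q_S n p (fun o => o = k) z -> Q_S n p S z).
  { apply gen_mono. intros z (i' & j' & Hi' & Hij' & Hj' & Hk' & ->).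
    apply gen_in. exists i', j'. destruct Hk' as [-> | ->]; auto 10. }
  split; now apply Hsub.
Qed.

(** * Homomorphisms and generation of the pure braid group *)

Lemma is_hom_one (G H : group) (f : G -> H) : is_hom G H f -> f gone = gone.
Proof.
  intros Hf. apply (mulg_cancel (f gone)). now rewrite <- Hf, gmul1, mulg1.
Qed.

Lemma is_hom_inv (G H : group) (f : G -> H) (x : G) :
  is_hom G H f -> f x^-1 = (f x)^-1.
Proof.
  intros Hf. apply (mulg_cancel (f x)).
  now rewrite <- Hf, !mulgV, (is_hom_one _ _ _ Hf).
Qed.

Lemma is_hom_comm (G H : group) (f : G -> H) (x y : G) :
  is_hom G H f -> f (comm x y) = comm (f x) (f y).
Proof. intros Hf. unfold comm. now rewrite !Hf, !(is_hom_inv _ _ _ _ Hf). Qed.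

Lemma hom_gen_one (G H : group) (f : G -> H) (X : G -> Prop) :
  is_hom G H f -> (forall x, X x -> f x = gone) ->
  forall x, gen X x -> f x = gone.
Proof.
  intros Hf HX x Hx; induction Hx as [|x Hx|x _ IH|x y _ IHx _ IHy].
  - now apply is_hom_one.
  - auto.
  - now rewrite (is_hom_inv _ _ _ _ Hf), IH, inv1.
  - now rewrite Hf, IHx, IHy, gmul1.
Qed.

Lemma hom_gen_fix (G : group) (f : G -> G) (X : G -> Prop) :
  is_hom G G f -> (forall x, X x -> f x = x) -> forall x, gen X x -> f x = x.
Proof.
  intros Hf HX x Hx; induction Hx as [|x Hx|x _ IH|x y _ IHx _ IHy].
  - now apply is_hom_one.
  - auto.
  - now rewrite (is_hom_inv _ _ _ _ Hf), IH.
  - now rewrite Hf, IHx, IHy.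
Qed.

Lemma sig_eq (T : Type) (P : T -> Prop) (x y : {t : T | P t}) :
  proj1_sig x = proj1_sig y -> x = y.
Proof.
  destruct x as [x Hx], y as [y Hy]; cbn; intros ->.
  f_equal. apply proof_irrelevance.
Qed.

Definition subgroup (G : group) (X : G -> Prop) : group.
Proof.
  refine (Group {x : G | gen X x}
    (fun x y => exist _ (proj1_sig x * proj1_sig y)
                  (gen_mul X _ _ (proj2_sig x) (proj2_sig y)))
    (fun x => exist _ (proj1_sig x)^-1 (gen_inv X _ (proj2_sig x)))
    (exist _ gone (gen_one X)) _ _ _); intros; apply sig_eq; cbn.
  - apply gmulA.
  - apply gmul1.
  - apply gmulV.
Defined.

(** Universality maps [G] into the subgroup generated by the [p a b]. Followed by the inclusion,
    this map agrees with the identity by uniqueness. *)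
Lemma pure_braid_generated (n : nat) (G : group) (p : nat -> nat -> G) :
  is_pure_braid_group n G p -> forall x, gen (generators n p) x.
Proof.
  intros [HR HU].
  (* Outside [1 <= a < b <= n] the family [p] need not lie in the subgroup. *)
  assert (Hq : exists q : nat -> nat -> subgroup G (generators n p),
    forall a b, 1 <= a -> a < b -> b <= n -> proj1_sig (q a b) = p a b).
  { assert (Hin : forall a b, 1 <= a /\ a < b /\ b <= n -> gen (generators n p) (p a b)).
    { intros a b (? & ? & ?). apply gen_in. exists a, b. auto. }
    assert (D : forall a b, {1 <= a /\ a < b /\ b <= n} + {~ (1 <= a /\ a < b /\ b <= n)}).
    { intros a b. destruct (le_dec 1 a), (lt_dec a b), (le_dec b n); tauto. }
    exists (fun a b => match D a b with
                       | left h => exist _ (p a b) (Hin a b h)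
                       | right _ => (gone : subgroup G (generators n p))
                       end).
    intros a b Ha Hab Hb. destruct (D a b); [reflexivity|lia]. }
  destruct Hq as [q Hq].
  destruct (HU (subgroup G (generators n p)) q) as (f & Hf & Hfq & _).
  { destruct HR as (RA & RB & RC); split; [|split].
    - intros a b c **; split; apply sig_eq; cbn; rewrite !Hq by lia;
        now apply (RA a b c).
    - intros a b c d **; split; apply sig_eq; cbn; rewrite !Hq by lia;
        now apply (RB a b c d).
    - intros a b c d **; apply sig_eq; cbn; rewrite !Hq by lia;
        now apply (RC a b c d). }
  destruct (HU G p HR) as (h & _ & _ & Huniq).
  intros x.
  replace x with (proj1_sig (f x)); [exact (proj2_sig (f x))|].
  transitivity (h x).
  - apply (Huniq (fun y => proj1_sig (f y))).
    + intros y z. now rewrite Hf.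
    + intros a b Ha Hab Hb. now rewrite Hfq, Hq.
  - symmetry. apply (Huniq (fun y => y)); [intros y z|]; reflexivity.
Qed.

(** * Retractions forgetting strands *)

Definition is_retraction (n : nat) {G : group} (p : nat -> nat -> G)
    (keep : nat -> bool) (r : G -> G) : Prop :=
  is_hom G G r /\ forall a b, 1 <= a -> a < b -> b <= n ->
    r (p a b) = if keep a && keep b then p a b else gone.

(** When the generators touching a forgotten strand become trivial, each relation either survives or
    reduces to a triviality. *)
Lemma retraction_exists (n : nat) (G : group) (p : nat -> nat -> G) (keep : nat -> bool) :
  is_pure_braid_group n G p -> exists r, is_retraction n p keep r.
Proof.
  intros [(RA & RB & RC) HU].
  destruct (HU G (fun a b => if keep a && keep b then p a b else gone))
    as (r & Hr & Hrp & _); [|now exists r].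
  split; [|split].
  - intros a b c H1 H2 H3 H4. destruct (RA a b c H1 H2 H3 H4).
    destruct (keep a), (keep b), (keep c); cbn; now rewrite ?mulg1, ?gmul1.
  - intros a b c d H1 H2 H3 H4 H5. destruct (RB a b c d H1 H2 H3 H4 H5).
    destruct (keep a), (keep b), (keep c), (keep d); cbn; now rewrite ?mulg1, ?gmul1.
  - intros a b c d H1 H2 H3 H4 H5. pose proof (RC a b c d H1 H2 H3 H4 H5).
    destruct (keep a), (keep b), (keep c), (keep d); cbn;
      auto; now grp.
Qed.

(** * Commutators with formal support *)

(* [T] is a bitmask recording the indices of the generators occurring in the
   commutator.  The order of [nat] then extends inclusion of supports. *)
Inductive commutator_on (n : nat) {G : group} (p : nat -> nat -> G) : nat -> G -> Prop :=
  | on_gen : forall a b, 1 <= a -> a < b -> b <= n ->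
      commutator_on n p (Nat.lor (2 ^ a) (2 ^ b)) (p a b)
  | on_geninv : forall a b, 1 <= a -> a < b -> b <= n ->
      commutator_on n p (Nat.lor (2 ^ a) (2 ^ b)) (p a b)^-1
  | on_comm : forall T U x y, commutator_on n p T x -> commutator_on n p U y ->
      commutator_on n p (Nat.lor T U) (comm x y).

Lemma testbit_pair (a b k : nat) :
  Nat.testbit (Nat.lor (2 ^ a) (2 ^ b)) k = true <-> k = a \/ k = b.
Proof.
  rewrite Nat.lor_spec, orb_true_iff, !Nat.pow2_bits_eqb, !Nat.eqb_eq. intuition.
Qed.

Lemma lor_ge_r (T U : nat) : U <= Nat.lor T U.
Proof.
  apply Nat.ldiff_le. apply Nat.bits_inj. intros k.
  rewrite Nat.ldiff_spec, Nat.lor_spec, Nat.bits_0.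
  now destruct (Nat.testbit T k), (Nat.testbit U k).
Qed.

Lemma lor_lt_pow2 (T U N : nat) : T < 2 ^ N -> U < 2 ^ N -> Nat.lor T U < 2 ^ N.
Proof.
  intros HT HU.
  destruct (Nat.eq_dec T 0) as [->|NT]; [now rewrite Nat.lor_0_l|].
  destruct (Nat.eq_dec U 0) as [->|NU]; [now rewrite Nat.lor_0_r|].
  apply Nat.log2_lt_pow2.
  - pose proof (lor_ge_r T U). lia.
  - rewrite Nat.log2_lor. apply Nat.max_lub_lt; apply Nat.log2_lt_pow2; lia.
Qed.

Lemma comm_1l {G : group} (y : G) : comm gone y = gone.
Proof. unfold comm; now grp. Qed.

Lemma comm_1r {G : group} (x : G) : comm x gone = gone.
Proof. unfold comm; now grp. Qed.

Lemma commV {G : group} (x y : G) : (comm x y)^-1 = comm y x.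
Proof. unfold comm; now grp. Qed.

Lemma commutator_on_gen (n : nat) (G : group) (p : nat -> nat -> G) (T : nat) (x : G) :
  commutator_on n p T x -> gen (generators n p) x.
Proof.
  intros H; induction H as [a b|a b|]; [| |unfold comm; auto 10 using gen_mul, gen_inv];
    [|apply gen_inv]; apply gen_in; exists a, b; auto.
Qed.

(** Indices up to [n] occupy bits up to [n], hence the exponent [n + 1]. This bound makes collection
    terminate. *)
Lemma commutator_on_bound (n : nat) (G : group) (p : nat -> nat -> G) (T : nat) (x : G) :
  commutator_on n p T x -> T < 2 ^ (n + 1).
Proof.
  intros H; induction H; apply lor_lt_pow2; auto; apply Nat.pow_lt_mono_r; lia.
Qed.

Lemma commutator_on_inv (n : nat) (G : group) (p : nat -> nat -> G) (T : nat) (x : G) :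
  commutator_on n p T x -> commutator_on n p T x^-1.
Proof.
  intros H; destruct H.
  - now apply on_geninv.
  - rewrite invV. now apply on_gen.
  - rewrite commV, Nat.lor_comm. now apply on_comm.
Qed.

(** Formal commutators may collapse to [gone], which the monic ones exclude. *)
Lemma commutator_on_monic (n : nat) (G : group) (p : nat -> nat -> G) (T : nat) (x : G) :
  commutator_on n p T x -> x = gone \/ monic n p x.
Proof.
  intros H; induction H as [a b Ha Hab Hb|a b Ha Hab Hb|T U x y _ [->|IHx] _ [->|IHy]];
    rewrite ?comm_1l, ?comm_1r; auto using monic_gen, monic_geninv.
  destruct (classic (comm x y = gone)); auto using monic_comm.
Qed.

Lemma monic_commutator_on (n : nat) (G : group) (p : nat -> nat -> G) (x : G) :
  monic n p x -> exists T, commutator_on n p T x.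
Proof.
  intros H; induction H as [a b|a b|x y _ [T HT] _ [U HU] _];
    eauto using @on_gen, @on_geninv, @on_comm.
Qed.

Lemma commutator_on_P (n : nat) (G : group) (p : nat -> nat -> G) (T : nat) (x : G) :
  commutator_on n p T x ->
  P_S n p (fun k => 1 <= k <= n /\ Nat.testbit T k = true) x.
Proof.
  assert (Hp : forall a b, 1 <= a -> a < b -> b <= n ->
    P_S n p (fun k => 1 <= k <= n /\ Nat.testbit (Nat.lor (2 ^ a) (2 ^ b)) k = true) (p a b)).
  { intros a b Ha Hab Hb. apply gen_in. exists a, b.
    repeat split; try lia; apply testbit_pair; auto. }
  assert (Hmono : forall (S S' : nat -> Prop), (forall k, S k -> S' k) ->
    forall y : G, P_S n p S y -> P_S n p S' y).
  { intros S S' HS. apply gen_mono. intros y (a & b & Ha & Hab & Hb & Sa & Sb & ->).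
    apply gen_in. exists a, b. auto 10. }
  intros H; induction H as [a b|a b|T U x y _ IHx _ IHy].
  - auto.
  - apply gen_inv. now apply Hp.
  - assert (Hx : P_S n p (fun k => 1 <= k <= n /\ Nat.testbit (Nat.lor T U) k = true) x).
    { revert IHx. apply Hmono. intros k [Hk HT]. now rewrite Nat.lor_spec, HT. }
    assert (Hy : P_S n p (fun k => 1 <= k <= n /\ Nat.testbit (Nat.lor T U) k = true) y).
    { revert IHy. apply Hmono. intros k [Hk HU].
      now rewrite Nat.lor_spec, HU, orb_true_r. }
    unfold comm. repeat apply gen_mul; try apply gen_inv; assumption.
Qed.

(** A commutator with a trivial entry is trivial, so forgetting one strand of the mask suffices. *)
Lemma retraction_kills (n : nat) (G : group) (p : nat -> nat -> G)
    (keep : nat -> bool) (r : G -> G) (T k : nat) (x : G) :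
  is_retraction n p keep r -> commutator_on n p T x ->
  Nat.testbit T k = true -> keep k = false -> r x = gone.
Proof.
  intros [Hr Hrp] H Hk Hkeep.
  assert (Hp : forall a b, 1 <= a -> a < b -> b <= n ->
    Nat.testbit (Nat.lor (2 ^ a) (2 ^ b)) k = true -> r (p a b) = gone).
  { intros a b Ha Hab Hb Hab'. rewrite Hrp by assumption.
    apply testbit_pair in Hab' as [<-|<-]; rewrite Hkeep; [|rewrite andb_false_r];
      reflexivity. }
  induction H as [a b|a b|T U x y _ IHx _ IHy].
  - auto.
  - rewrite (is_hom_inv _ _ _ _ Hr), Hp by assumption. apply inv1.
  - rewrite (is_hom_comm _ _ _ _ _ Hr). rewrite Nat.lor_spec, orb_true_iff in Hk.
    destruct Hk as [Hk|Hk]; [rewrite IHx, comm_1l|rewrite IHy, comm_1r]; auto.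
Qed.

Lemma retraction_fixes (n : nat) (G : group) (p : nat -> nat -> G)
    (keep : nat -> bool) (r : G -> G) (S : nat -> Prop) (x : G) :
  is_retraction n p keep r -> (forall k, S k -> keep k = true) ->
  P_S n p S x -> r x = x.
Proof.
  intros [Hr Hrp] HS. apply hom_gen_fix; [assumption|].
  intros y (a & b & Ha & Hab & Hb & Sa & Sb & ->).
  now rewrite Hrp, (HS a), (HS b).
Qed.

Lemma retraction_kills_Q (n : nat) (G : group) (p : nat -> nat -> G)
    (keep : nat -> bool) (r : G -> G) (S : nat -> Prop) (x : G) :
  is_retraction n p keep r -> (forall k, 1 <= k <= n -> S k -> keep k = false) ->
  Q_S n p S x -> r x = gone.
Proof.
  intros [Hr Hrp] HS. apply hom_gen_one; [assumption|].
  intros y (a & b & Ha & Hab & Hb & Sab & ->). rewrite Hrp by assumption.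
  destruct Sab as [Sa|Sb]; [rewrite (HS a)|rewrite (HS b), andb_false_r];
    reflexivity || lia || assumption.
Qed.

(** One entry involves [k] and lies in [Q_S]; the commutator is a product of that entry, or its
    inverse, and a conjugate, so normality applies. *)
Lemma commutator_on_Q (n : nat) (G : group) (p : nat -> nat -> G)
    (T k : nat) (S : nat -> Prop) (x : G) :
  braid_rels n G p -> commutator_on n p T x ->
  Nat.testbit T k = true -> S k -> Q_S n p S x.
Proof.
  intros HR H Hk HS.
  assert (Hp : forall a b, 1 <= a -> a < b -> b <= n ->
    Nat.testbit (Nat.lor (2 ^ a) (2 ^ b)) k = true -> Q_S n p S (p a b)).
  { intros a b Ha Hab Hb Hab'. apply gen_in. exists a, b.
    apply testbit_pair in Hab' as [<-|<-]; auto 10. }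
  induction H as [a b|a b|T U x y Hx IHx Hy IHy].
  - auto.
  - apply gen_inv. now apply Hp.
  - rewrite Nat.lor_spec, orb_true_iff in Hk. destruct Hk as [Hk|Hk].
    + rewrite comm_conj. apply gen_mul; [apply gen_inv; now apply IHx|].
      now apply (Q_normal n G p S y); eauto using commutator_on_gen.
    + replace (comm x y) with (conjg x^-1 y^-1 * y) by (unfold comm, conjg; now grp).
      apply gen_mul; [|now apply IHy].
      apply (Q_normal n G p S x); eauto using commutator_on_gen.
      apply gen_inv. now apply IHy.
Qed.

(** If [x] lay in [P_S] with [k] outside [S], the retraction forgetting [k] would both fix and kill
    it. *)
Lemma commutator_on_support (n : nat) (G : group) (p : nat -> nat -> G)
    (T k : nat) (x : G) :
  is_pure_braid_group n G p -> commutator_on n p T x -> x <> gone ->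
  Nat.testbit T k = true -> support n p x k.
Proof.
  intros HP H Hx Hk S HS HPS. destruct (classic (S k)) as [|NS]; [assumption|].
  destruct (retraction_exists n G p (fun j => negb (j =? k)) HP) as [r Hr].
  exfalso; apply Hx.
  rewrite <- (retraction_fixes _ _ _ _ _ S x Hr); [|intros j Sj|assumption].
  - apply (retraction_kills _ _ _ _ _ T k x Hr H Hk). now rewrite Nat.eqb_refl.
  - destruct (Nat.eqb_spec j k) as [->|]; [contradiction|reflexivity].
Qed.

(** * Commutator collection and the intersection *)

Definition commutators_from (n : nat) {G : group} (p : nat -> nat -> G) (t : nat) : G -> Prop :=
  gen (fun x => exists U, t <= U /\ commutator_on n p U x).

(** Factors of mask [t] can be moved to the left past later ones because they normalize the subgroup
    of larger masks. *)
Lemma collect (n : nat) (G : group) (p : nat -> nat -> G) (t : nat) (x : G) :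
  commutators_from n p t x ->
  exists y z, gen (commutator_on n p t) y /\ commutators_from n p (t + 1) z /\ x = y * z.
Proof.
  assert (HN : forall g, gen (commutator_on n p t) g ->
                normalizes (commutators_from n p (t + 1)) g).
  { apply normalizes_by_gen. intros g Hg. apply normalizes_gen.
    assert (H : forall h, commutator_on n p t h -> forall y,
      (exists U, t + 1 <= U /\ commutator_on n p U y) ->
      commutators_from n p (t + 1) (conjg h^-1 y)).
    { intros h Hh y (U & HtU & Hy).
      replace (conjg h^-1 y) with (y * comm y h) by (unfold comm, conjg; now grp).
      apply gen_mul; apply gen_in; [exists U; now split|].
      (* The correcting commutator has mask at least [U], so it stays beyond [t]. *)
      exists (Nat.lor t U). split; [pose proof (lor_ge_r t U); lia|].
      rewrite Nat.lor_comm. now apply on_comm. }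
    intros y Hy. split; [|now apply H].
    rewrite <- (invV g). apply H; auto using commutator_on_inv. }
  intros Hx; induction Hx as [|x (U & HtU & HU)|x _ IH|x y _ IHx _ IHy].
  - exists gone, gone. repeat split; try apply gen_one. now grp.
  - destruct (Nat.eq_dec U t) as [->|NU].
    + exists x, gone. repeat split; [now apply gen_in|apply gen_one|now grp].
    + exists gone, x. repeat split; [apply gen_one| |now grp].
      apply gen_in. exists U. split; [lia|assumption].
  - destruct IH as (y & z & Hy & Hz & ->).
    exists y^-1, (conjg y z^-1). repeat split.
    + now apply gen_inv.
    + apply HN; [assumption|]. now apply gen_inv.
    + unfold conjg. now grp.
  - destruct IHx as (y1 & z1 & Hy1 & Hz1 & ->), IHy as (y2 & z2 & Hy2 & Hz2 & ->).
    exists (y1 * y2), (conjg y2^-1 z1 * z2). repeat split.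
    + now apply gen_mul.
    + apply gen_mul; [|assumption]. now apply HN.
    + unfold conjg. now grp.
Qed.

Lemma intersection_generated (n : nat) (G : group) (p : nat -> nat -> G)
    (m : nat) (S : nat -> nat -> Prop) (d t : nat) (x : G) :
  is_pure_braid_group n G p -> t + d = 2 ^ (n + 1) ->
  commutators_from n p t x -> (forall i, 1 <= i <= m -> Q_S n p (S i) x) ->
  gen (fun y => exists U, commutator_on n p U y /\
         forall i, 1 <= i <= m -> exists k, Nat.testbit U k = true /\ S i k) x.
Proof.
  intros HP; revert t x; induction d as [|d IH]; intros t x Ht Hx HQ.
  (* No mask reaches [2 ^ (n + 1)], so there are no generators left. *)
  - eapply gen_mono; [|exact Hx]. intros y (U & HtU & HU).
    apply commutator_on_bound in HU. lia.
  - destruct (collect n G p t x Hx) as (y & z & Hy & Hz & ->).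
    destruct (classic (forall i, 1 <= i <= m ->
                         exists k, Nat.testbit t k = true /\ S i k)) as [Hmeet|Hmiss].
    + apply gen_mul.
      * revert Hy; apply gen_mono. intros g Hg. apply gen_in. now exists t.
      * apply (IH (t + 1)); [lia|assumption|]. intros i Hi.
        replace z with (y^-1 * (y * z)) by now grp.
        apply gen_mul; [|now apply HQ]. apply gen_inv.
        destruct (Hmeet i Hi) as (k & Hk & HS). revert Hy; apply gen_mono.
        intros g Hg. apply (commutator_on_Q n G p t k); auto. apply HP.
    + assert (Hi : exists i, 1 <= i <= m /\ forall k, S i k -> Nat.testbit t k = false).
      { apply not_all_ex_not in Hmiss as [i Hi].
        apply imply_to_and in Hi as [Hi Hno]. exists i. split; [assumption|].
        intros k HS. apply not_true_is_false. intros Hk. apply Hno. now exists k. }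
      destruct Hi as (i & Hi & HS).
      (* Keeping exactly the strands of [t] fixes [y], kills [z], and kills the product since [S i]
         misses [t]. *)
      destruct (retraction_exists n G p (Nat.testbit t) HP) as [r Hr].
      assert (ry : r y = y).
      { apply (hom_gen_fix _ _ _ (proj1 Hr)) with (2 := Hy). intros g Hg.
        apply (retraction_fixes _ _ _ _ _ _ _ Hr) with (2 := commutator_on_P _ _ _ _ _ Hg).
        now intros k [_ Hk]. }
      assert (rz : r z = gone).
      { apply (hom_gen_one _ _ _ _ (proj1 Hr)) with (2 := Hz). intros g (U & HtU & HU).
        (* A mask whose bits all occur in [t] is at most [t], whereas [U] exceeds [t]. *)
        assert (Hk : exists k, Nat.testbit U k = true /\ Nat.testbit t k = false).
        { apply NNPP. intros Hno. apply (Nat.lt_irrefl t).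
          apply (Nat.lt_le_trans _ U); [lia|].
          apply Nat.ldiff_le. apply Nat.bits_inj. intros k.
          rewrite Nat.ldiff_spec, Nat.bits_0.
          destruct (Nat.testbit U k) eqn:EU, (Nat.testbit t k) eqn:Et; try reflexivity.
          exfalso. apply Hno. now exists k. }
        destruct Hk as (k & HUk & Htk). exact (retraction_kills _ _ _ _ _ U k g Hr HU HUk Htk). }
      assert (Hy1 : y = gone).
      { transitivity (r (y * z)); [now rewrite (proj1 Hr), ry, rz, mulg1|].
        apply (retraction_kills_Q n G p _ r (S i) _ Hr); auto. }
      subst y. rewrite gmul1 in *. apply (IH (t + 1)); auto. lia.
Qed.

Local Close Scope grp_scope.

Theorem theorem2p1 (n : nat) (G : group) (p : nat -> nat -> G)
  (HP : is_pure_braid_group n G p)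
  (m : nat) (S : nat -> nat -> Prop)
  (HS : forall i k, 1 <= i <= m -> S i k -> 1 <= k <= n) :
  forall x : G,
    (forall i, 1 <= i <= m -> Q_S n p (S i) x) <->
    gen (fun y => monic n p y /\
                  forall i, 1 <= i <= m -> exists k, support n p y k /\ S i k) x.
Proof.
  intros x; split.
  - intros HQ.
    apply (gen_mono (fun y => exists U, commutator_on n p U y /\
      forall i, 1 <= i <= m -> exists k, Nat.testbit U k = true /\ S i k)).
    + intros y (U & HU & Hmeet).
      destruct (classic (y = gone)) as [->|Hy]; [apply gen_one|].
      destruct (commutator_on_monic _ _ _ _ _ HU) as [|Hmonic]; [contradiction|].
      apply gen_in. split; [assumption|]. intros i Hi.
      destruct (Hmeet i Hi) as (k & Hk & HSk). exists k. split; [|assumption].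
      now apply (commutator_on_support n G p U).
    + apply (intersection_generated n G p m S (2 ^ (n + 1)) 0); auto.
      eapply gen_mono; [|apply (pure_braid_generated n G p HP)].
      intros y (a & b & Ha & Hab & Hb & ->). apply gen_in.
      exists (Nat.lor (2 ^ a) (2 ^ b)). split; [lia|now apply on_gen].
  - intros Hx i Hi. revert Hx. apply gen_mono. intros y [Hmonic Hmeet].
    destruct (monic_commutator_on _ _ _ _ Hmonic) as [U HU].
    destruct (Hmeet i Hi) as (k & Hk & HSk).
    (* The support is contained in the strands of the mask, as [y] lies in their subgroup. *)
    assert (Hbit : 1 <= k <= n /\ Nat.testbit U k = true).
    { apply (Hk (fun j => 1 <= j <= n /\ Nat.testbit U j = true)); [tauto|].
      now apply commutator_on_P. }
    apply (commutator_on_Q n G p U k); try assumption; [apply HP|apply Hbit].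
Qed.
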